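(* Let $\mathcal{C}$ be a congruence-modular equational class of algebras such that $[\nabla_M,\nabla_M]_M=\nabla_M$ for every algebra $M$ from $\mathcal{C}$. Let $n\in\mathbb{N}$, $n\ge1$, and, for every $i\in\{1,\ldots,n\}$, let $A_i$ and $B_i$ be algebras from $\mathcal{C}$ and $f_i:A_i\to B_i$ a morphism in $\mathcal{C}$. Let $\prod_{i=1}^nf_i:\prod_{i=1}^nA_i\to\prod_{i=1}^nB_i$ be the componentwise product morphism. Then: (1) $\prod_{i=1}^nf_i$ is Max-admissible iff $f_1,\ldots,f_n$ are all Max-admissible; (2) $\prod_{i=1}^nf_i$ is admissible iff $f_1,\ldots,f_n$ are all admissible.
   Context: All algebras are non-empty. $\mathrm{Con}(M)$ is the lattice of congruences of $M$ ordered by inclusion, with greatest element $\nabla_M=M^2$. $\mathrm{Max}(M)$ is the set of maximal elements of $\mathrm{Con}(M)\setminus\{\nabla_M\}$. An equational class (variety) is congruence-modular if $\mathrm{Con}(M)$ is modular for each member $M$. In a congruence-modular equational class, $[\alpha,\beta]_M$ denotes the (Freese–McKenzie) commutator of $\alpha,\beta\in \mathrm{Con}(M)$: the least $\delta\in \mathrm{Con}(M)$ such that for all $m,n$, every $(m+n)$-ary term $t$, all $(a_i,b_i)\in\alpha$ ($1\le i\le m$) and all $(c_j,d_j)\in\beta$ ($1\le j\le n$), $(t(\bar a,\bar c),t(\bar a,\bar d))\in\delta$ implies $(t(\bar b,\bar c),t(\bar b,\bar d))\in\delta$. A proper congruence $\phi\neq\nabla_M$ is prime if, for all $\alpha,\beta\in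 \mathrm{Con}(M)$, $[\alpha,\beta]_M\subseteq\phi$ implies $\alpha\subseteq\phi$ or $\beta\subseteq\phi$; $\mathrm{Spec}(M)$ is the set of prime congruences of $M$. For a morphism $f:A\to B$ and $\psi\in \mathrm{Con}(B)$, $f^*(\psi)=\{(a,b)\in A^2 : (f(a),f(b))\in\psi\}\in \mathrm{Con}(A)$. The morphism $f$ is admissible if $f^*(\psi)\in \mathrm{Spec}(A)$ for all $\psi\in \mathrm{Spec}(B)$, and Max-admissible if $f^*(\psi)\in \mathrm{Max}(A)$ for all $\psi\in \mathrm{Max}(B)$. For a congruence-modular $\mathcal{C}$ it is known (Freese–McKenzie, Theorem 8.5) that the hypothesis $[\nabla_M,\nabla_M]_M=\nabla_M$ for all $M$ in $\mathcal{C}$ is equivalent to: $[\theta,\nabla_M]_M=\theta$ for all $M$ in $\mathcal{C}$ and $\theta\in \mathrm{Con}(M)$; and also to: for all finite families $M_1,\ldots,M_n$ in $\mathcal{C}$, the congruences of $\prod_i M_i$ are exactly the products $\prod_i\theta_i$ with $\theta_i\in \mathrm{Con}(M_i)$. *)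

(* Defs.v *)
From mathcomp Require Import all_boot boolp classical_sets.

Set Implicit Arguments.
Unset Strict Implicit.
Unset Printing Implicit Defensive.

Local Open Scope classical_set_scope.

Record signature := Signature {
  op : Type;
  arity : op -> nat
}.

Record algebra (S : signature) := Algebra {
  carrier :> Type;
  interp : forall o : op S, ('I_(arity o) -> carrier) -> carrier;
  carrier_inhabited : inhabited carrier
}.

Inductive term (S : signature) (V : Type) :=
| Var of V
| App (o : op S) of ('I_(arity o) -> term S V).

Fixpoint eval S (M : algebra S) V (v : V -> M) (t : term S V) : M :=
  match t with
  | Var x => v x
  | App o ts => interp (fun k => eval v (ts k))
  end.

Definition models S (E : set (term S nat * term S nat)) (M : algebra S) :=
  forall s t, E (s, t) -> forall v : nat -> M, eval v s = eval v t.

Definition equational_class S (C : algebra S -> Prop) :=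
  exists E, forall M, C M <-> models E M.

Record hom S (A B : algebra S) := Hom {
  hom_fun :> A -> B;
  hom_interp : forall (o : op S) (x : 'I_(arity o) -> A),
    hom_fun (interp x) = interp (fun k => hom_fun (x k))
}.

Section Product.
Variables (S : signature) (n : nat).

Lemma prod_inhabited (A : 'I_n -> algebra S) : inhabited (forall i, A i).
Proof.
split=> i; apply: (proj1_sig (cid (P := fun=> True) _)).
by case: (carrier_inhabited (A i)) => x; exists x.
Qed.

Definition prod_algebra (A : 'I_n -> algebra S) : algebra S :=
  @Algebra S (forall i, A i) (fun o x i => interp (fun k => x k i))
    (prod_inhabited A).

Definition prod_fun (A B : 'I_n -> algebra S) (f : forall i, hom (A i) (B i)) :
  prod_algebra A -> prod_algebra B := fun a i => f i (a i).

Lemma prod_fun_interp A B (f : forall i, hom (A i) (B i)) (o : op S)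
    (x : 'I_(arity o) -> prod_algebra A) :
  prod_fun f (interp x) = interp (fun k => prod_fun f (x k)).
Proof. by apply: functional_extensionality_dep => i; apply: hom_interp. Qed.

Definition prod_hom A B (f : forall i, hom (A i) (B i)) :
  hom (prod_algebra A) (prod_algebra B) := Hom (prod_fun_interp f).

End Product.

Section Congruences.
Variables (S : signature) (M : algebra S).
Implicit Types (alpha beta gamma delta theta phi : set (M * M)).

Record congruence theta : Prop := Congruence {
  congr_refl : forall x, theta (x, x);
  congr_sym : forall x y, theta (x, y) -> theta (y, x);
  congr_trans : forall x y z, theta (x, y) -> theta (y, z) -> theta (x, z);
  congr_interp : forall (o : op S) (x y : 'I_(arity o) -> M),
    (forall k, theta (x k, y k)) -> theta (interp x, interp y)
}.

Definition Con : set (set (M * M)) := [set theta | congruence theta].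

Definition nabla : set (M * M) := [set: M * M].

(* The meet of the lattice Con is set intersection. *)
Definition con_join alpha beta : set (M * M) := smallest Con (alpha `|` beta).

Definition modular_Con :=
  forall alpha beta gamma, Con alpha -> Con beta -> Con gamma ->
    alpha `<=` gamma ->
    con_join alpha (beta `&` gamma) = con_join alpha beta `&` gamma.

Definition Max : set (set (M * M)) :=
  [set phi | [/\ Con phi, phi <> nabla &
    forall theta, Con theta -> theta <> nabla -> phi `<=` theta ->
      theta = phi]].

Definition fcat m n (a : 'I_m -> M) (c : 'I_n -> M) (i : 'I_(m + n)) : M :=
  match split i with inl j => a j | inr k => c k end.

Definition centralizes alpha beta delta :=
  forall m n (t : term S 'I_(m + n)) (a b : 'I_m -> M) (c d : 'I_n -> M),
    (forall i, alpha (a i, b i)) -> (forall j, beta (c j, d j)) ->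
    delta (eval (fcat a c) t, eval (fcat a d) t) ->
    delta (eval (fcat b c) t, eval (fcat b d) t).

(* The intersection of all such delta; it is itself such a delta, hence the
   least one, by Con_commutator, centralizes_commutator, commutator_sub. *)
Definition commutator alpha beta : set (M * M) :=
  smallest [set delta | Con delta /\ centralizes alpha beta delta] set0.

Definition Spec : set (set (M * M)) :=
  [set phi | [/\ Con phi, phi <> nabla &
    forall alpha beta, Con alpha -> Con beta ->
      commutator alpha beta `<=` phi -> alpha `<=` phi \/ beta `<=` phi]].

Lemma Con_bigcap (F : set (set (M * M))) :
  F `<=` Con -> Con (\bigcap_(theta in F) theta).
Proof.
move=> FC; split.
- by move=> x theta /FC [].
- by move=> x y h theta Ft; apply: (congr_sym (FC _ Ft)); apply: h.
- move=> x y z h1 h2 theta Ft.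
  by apply: (congr_trans (FC _ Ft) (h1 _ Ft) (h2 _ Ft)).
- move=> o x y h theta Ft; apply: (congr_interp (FC _ Ft)) => k.
  exact: h.
Qed.

Lemma Con_join alpha beta : Con (con_join alpha beta).
Proof. by apply: Con_bigcap => theta []. Qed.

Lemma Con_commutator alpha beta : Con (commutator alpha beta).
Proof. by apply: Con_bigcap => theta [[]]. Qed.

Lemma centralizes_commutator alpha beta :
  centralizes alpha beta (commutator alpha beta).
Proof.
move=> m n t a b c d ab cd h delta Hd.
by case: (Hd) => -[_ Hc] _; apply: (Hc m n t a b c d ab cd); apply: h.
Qed.

Lemma commutator_sub alpha beta delta :
  Con delta -> centralizes alpha beta delta ->
  commutator alpha beta `<=` delta.
Proof. by move=> Cd Hd; apply: smallest_sub. Qed.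

End Congruences.

Arguments nabla {S} M.

Definition congruence_modular S (C : algebra S -> Prop) :=
  forall M, C M -> modular_Con M.

Definition hom_pullback S (A B : algebra S) (f : hom A B) (psi : set (B * B)) :
  set (A * A) := [set p | psi (f p.1, f p.2)].

Definition admissible S (A B : algebra S) (f : hom A B) :=
  forall psi, Spec psi -> Spec (hom_pullback f psi).

Definition Max_admissible S (A B : algebra S) (f : hom A B) :=
  forall psi, Max psi -> Max (hom_pullback f psi).

(* Main.v *)
Require Import Defs.
From mathcomp Require Import all_boot boolp classical_sets.
From Stdlib Require Import Relations.

(** The commutator enters through the relation [centralizes]. Modularity of
    the congruences of an algebra of term functions shows that [centralizes] is
    symmetric in its first two arguments and upward closed in the third; hence
    [commutator alpha beta `<=` delta] implies [centralizes alpha beta delta],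
    and then [alpha] and [beta] may be replaced by their joins with [delta].
    So prime congruences correspond to prime congruences along surjective
    morphisms. Since [commutator alpha beta `<=` alpha `&` beta], a prime
    congruence of a finite product contains the kernel of some projection; so
    does a maximal one, because it does not contain
    [commutator nabla nabla = nabla]. Thus the prime (maximal) congruences of
    the product are exactly those pulled back from the factors, compatibly with
    the morphisms. *)

Set Implicit Arguments.
Unset Strict Implicit.
Unset Printing Implicit Defensive.

Local Open Scope classical_set_scope.

(** * Terms, substitution and the term condition over finite index types *)

Section Terms.
Variable S : signature.

Fixpoint term_subst V W (s : V -> term S W) (t : term S V) : term S W :=
  match t with
  | Var x => s x
  | App o ts => App (fun k => term_subst s (ts k))
  end.

Lemma eval_subst (M : algebra S) V W (s : V -> term S W) (e : W -> M) t :
  eval e (term_subst s t) = eval (fun x => eval e (s x)) t.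
Proof. by elim: t => //= o ts IH; congr interp; apply/funext => k. Qed.

Lemma eval_hom (M N : algebra S) (f : hom M N) V (e : V -> M) t :
  f (eval e t) = eval (f \o e) t.
Proof.
elim: t => //= o ts IH; rewrite hom_interp; congr interp.
by apply/funext => k.
Qed.

Lemma eval_congr (M : algebra S) (theta : set (M * M)) V (e e' : V -> M) t :
  Con theta -> (forall x, theta (e x, e' x)) -> theta (eval e t, eval e' t).
Proof. by move=> Ct h; elim: t => //= o ts IH; apply: (congr_interp Ct). Qed.

Definition sum_fun I J T (a : I -> T) (c : J -> T) (v : I + J) : T :=
  match v with inl i => a i | inr j => c j end.

(** Renaming variables through [enum_rank] reduces arbitrary finite index types to the ordinals of
    [fcat]. This allows terms whose variables come in several blocks. *)
Lemma centralizesE (M : algebra S) (alpha beta delta : set (M * M)) :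
  centralizes alpha beta delta ->
  forall (I J : finType) (t : term S (I + J)) (a b : I -> M) (c d : J -> M),
    (forall i, alpha (a i, b i)) -> (forall j, beta (c j, d j)) ->
    delta (eval (sum_fun a c) t, eval (sum_fun a d) t) ->
    delta (eval (sum_fun b c) t, eval (sum_fun b d) t).
Proof.
move=> H I J t a b c d ab cd.
pose r (v : I + J) : term S 'I_(#|I| + #|J|) :=
  Var S (sum_fun (fun i => lshift _ (enum_rank i))
               (fun j => rshift _ (enum_rank j)) v).
have E (x : I -> M) (y : J -> M) : eval (sum_fun x y) t =
    eval (fcat (x \o enum_val) (y \o enum_val)) (term_subst r t).
  rewrite eval_subst; congr eval; apply/funext => -[i|j] /=; rewrite /fcat.
    by rewrite (unsplitK (inl (enum_rank i))) /= enum_rankK.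
  by rewrite (unsplitK (inr (enum_rank j))) /= enum_rankK.
by rewrite !E; apply: H => k /=.
Qed.

End Terms.

(* Proved by replacing the entries of [a] by those of [b] one at a time. *)
Lemma fun_change_ind (I : finType) T (R : T -> T -> Prop)
    (Q : (I -> T) -> Prop) :
  (forall g i y, R (g i) y -> Q g -> Q (fun j => if j == i then y else g j)) ->
  forall a b, (forall i, R (a i) (b i)) -> Q a -> Q b.
Proof.
move=> step a b ab Qa.
pose mix (s : seq I) i := if i \in s then b i else a i.
suff: Q (mix (enum I)).
  by congr Q; apply/funext => i; rewrite /mix mem_enum.
elim: (enum I) => [|i s IH].
  by move: Qa; congr Q; apply/funext.
have [si|nsi] := boolP (i \in s).
  move: IH; congr Q; apply/funext => j; rewrite /mix inE.
  by case: eqVneq => // ->; rewrite si.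
have := step _ i (b i) _ IH.
rewrite {1}/mix (negbTE nsi) => /(_ (ab i)).
congr Q; apply/funext => j; rewrite /mix inE.
by case: eqVneq => // ->.
Qed.

(** * Joins of congruences as chains, and elementary rules for the term condition *)

Section Join.
Variables (S : signature) (M : algebra S).
Implicit Types (alpha beta delta theta : set (M * M)).

Definition join_chain alpha beta : M -> M -> Prop :=
  clos_refl_trans M (fun x y => alpha (x, y) \/ beta (x, y)).

(** It suffices that chains form a congruence containing both. For an operation, the arguments are
    changed one at a time, and a chain in one argument is sent link by link to a chain of values. *)
Lemma con_join_chain alpha beta x y : Con alpha -> Con beta ->
  con_join alpha beta (x, y) -> join_chain alpha beta x y.
Proof.
move=> Ca Cb /(_ [set p | join_chain alpha beta p.1 p.2]); apply; split.
- split=> /=.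
  + by move=> z; apply: rt_refl.
  + move=> u v; elim.
    * move=> p q [h|h]; apply: rt_step.
        by left; apply: congr_sym h.
      by right; apply: congr_sym h.
    * by move=> p; apply: rt_refl.
    * by move=> p q r _ qp _ rq; apply: rt_trans rq qp.
  + by move=> u v w; apply: rt_trans.
  + move=> o u v uv.
    pose Q (w : 'I_(arity o) -> M) := join_chain alpha beta (interp u) (interp w).
    suff: Q v by [].
    apply: (fun_change_ind (Q := Q) _ uv); last exact: rt_refl.
    move=> g i z gz; rewrite /Q => Qg; apply: (rt_trans _ _ _ _ _ Qg).
    (* Writing [g] as its own update at [i] puts both ends in the same form, so the chain from [g i]
       to [z] can be followed by induction. *)
    have -> : interp g = interp (fun j => if j == i then g i else g j).
      by congr interp; apply/funext => j; case: eqVneq => // ->.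
    elim: gz => [p q pq|p|p q r _ h1 _ h2].
    * apply: rt_step; case: pq => pq; [left|right].
        by apply: congr_interp => // k; case: eqP => // _; apply: congr_refl.
      by apply: congr_interp => // k; case: eqP => // _; apply: congr_refl.
    * exact: rt_refl.
    * exact: rt_trans h1 h2.
- by move=> [u v] [h|h]; apply: rt_step; [left|right].
Qed.

Lemma con_join_subl alpha beta : alpha `<=` con_join alpha beta.
Proof. by move=> p ap theta [_]; apply; left. Qed.

Lemma con_join_subr alpha beta : beta `<=` con_join alpha beta.
Proof. by move=> p bp theta [_]; apply; right. Qed.

Lemma Con_setI alpha beta : Con alpha -> Con beta -> Con (alpha `&` beta).
Proof.
move=> Ca Cb; split=> [x|x y [h1 h2]|x y z [h1 h2] [h3 h4]|o x y h].
- by split; apply: congr_refl.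
- by split; apply: congr_sym.
- by split; [apply: congr_trans h1 h3|apply: congr_trans h2 h4].
- by split; apply: congr_interp => // k; case: (h k).
Qed.

(** The first block is changed one coordinate at a time, each along a chain. A single link is an
    instance of one of the two given conditions, the other coordinates being related by
    reflexivity. *)
Lemma centralizes_join alpha1 alpha2 beta delta :
  Con alpha1 -> Con alpha2 -> Con delta ->
  centralizes alpha1 beta delta -> centralizes alpha2 beta delta ->
  centralizes (con_join alpha1 alpha2) beta delta.
Proof.
move=> C1 C2 Cd H1 H2 m n t a b c d ab cd.
pose Q w := delta (eval (fcat w c) t, eval (fcat w d) t).
apply: (fun_change_ind (Q := Q) (R := join_chain alpha1 alpha2)) => //;
  last by move=> i; apply: con_join_chain.
move=> g i z gz.
have {1}-> : g = (fun j => if j == i then g i else g j).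
  by apply/funext => j; case: eqVneq => // ->.
elim: gz => // [p q [pq|pq]|p q r _ h1 _ h2]; last by move/h1/h2.
- apply: H1 => // k; case: eqP => // _; exact: congr_refl.
- apply: H2 => // k; case: eqP => // _; exact: congr_refl.
Qed.

Lemma fcat_congr theta m n (a b : 'I_m -> M) (c d : 'I_n -> M) :
  (forall i, theta (a i, b i)) -> (forall j, theta (c j, d j)) ->
  forall k, theta (fcat a c k, fcat b d k).
Proof. by move=> ab cd k; rewrite /fcat; case: split. Qed.

(** Passing from [a] to [b] moves values only within [delta], whatever the second block is;
    transitivity does the rest. *)
Lemma centralizes_subl alpha beta delta :
  Con delta -> alpha `<=` delta -> centralizes alpha beta delta.
Proof.
move=> Cd ad m n t a b c d ab cd h.
have E (e : 'I_n -> M) : delta (eval (fcat a e) t, eval (fcat b e) t).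
  apply: eval_congr => //; apply: fcat_congr => i; first exact/ad.
  exact: congr_refl.
apply: (congr_trans Cd _ (E d)); apply: (congr_trans Cd _ h).
exact: congr_sym (E c).
Qed.

Lemma centralizes_subr alpha beta delta :
  Con delta -> beta `<=` delta -> centralizes alpha beta delta.
Proof.
move=> Cd bd m n t a b c d ab cd _.
apply: eval_congr => //; apply: fcat_congr => i; last exact/bd.
exact: congr_refl.
Qed.

(** The term condition holds modulo [alpha] and modulo [beta], and the commutator is the least
    congruence for which it holds. *)
Lemma commutator_subI alpha beta : Con alpha -> Con beta ->
  commutator alpha beta `<=` alpha `&` beta.
Proof.
move=> Ca Cb p h; split; move: p h; apply: commutator_sub => //.
  exact: centralizes_subl.
exact: centralizes_subr.
Qed.

End Join.

(** * Algebras of term functions *)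

Section TermFunctions.
Variables (S : signature) (M : algebra S) (V : Type).

(** This is the free algebra on [V] in the variety generated by [M]. Taking functions instead of
    terms makes equality mean agreement under all assignments. *)
Definition term_fun := {g : (V -> M) -> M | exists t, g = (fun e => eval e t)}.

Lemma term_fun_eq (g h : term_fun) : sval g = sval h -> g = h.
Proof. by case: g h => g pg [h ph] /= E; subst h; congr exist. Qed.

Lemma term_fun_interp_subproof (o : op S) (x : 'I_(arity o) -> term_fun) :
  exists t, (fun e => interp (fun k => sval (x k) e)) = (fun e => eval e t).
Proof.
have /choice [ts tsP] : forall k, exists t, sval (x k) = (fun e => eval e t).
  by move=> k; case: (x k).
exists (App ts); apply/funext => e /=; congr interp; apply/funext => k.
by rewrite tsP.
Qed.

Definition term_fun_interp (o : op S) (x : 'I_(arity o) -> term_fun) :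
  term_fun := exist _ _ (term_fun_interp_subproof x).

Definition term_fun_var (v : V) : term_fun :=
  exist _ (fun e : V -> M => e v) (ex_intro _ (Var S v) erefl).

Lemma term_fun_inhabited : inhabited V -> inhabited term_fun.
Proof. by case=> v; split; apply: term_fun_var v. Qed.

Variable V_inhabited : inhabited V.

Definition term_fun_algebra : algebra S :=
  Algebra term_fun_interp (term_fun_inhabited V_inhabited).

Lemma eval_term_fun W (v : W -> term_fun_algebra) t (e : V -> M) :
  sval (eval v t) e = eval (fun x => sval (v x) e) t.
Proof. by elim: t => //= o ts IH; congr interp; apply/funext => k. Qed.

Lemma equational_class_term_fun (C : algebra S -> Prop) :
  equational_class C -> C M -> C term_fun_algebra.
Proof.
move=> [E EP] /EP CM; apply/EP => s t st v.
by apply/term_fun_eq/funext => e; rewrite !eval_term_fun; apply: CM.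
Qed.

(** The kernel of restriction to the assignments in [P]. *)
Definition agree_on (P : (V -> M) -> Prop) :
    set (term_fun_algebra * term_fun_algebra) :=
  [set p | forall e, P e -> sval p.1 e = sval p.2 e].

Lemma Con_agree_on P : Con (agree_on P).
Proof.
split=> /= [x e //|x y h e /h //|x y z h1 h2 e Pe|o x y h e Pe].
  by rewrite h1 ?h2.
by congr interp; apply/funext => k; apply: h.
Qed.

End TermFunctions.

Lemma equational_class_prod S (C : algebra S -> Prop) n
    (A : 'I_n -> algebra S) :
  equational_class C -> (forall i, C (A i)) -> C (prod_algebra A).
Proof.
move=> [E EP] CA; apply/EP => s t st v.
have ev i u : eval v u i = eval (fun x => v x i) u.
  by elim: u => //= o ts IH; congr interp; apply/funext => k.
apply: functional_extensionality_dep => i; rewrite !ev.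
by move/EP: (CA i); apply.
Qed.

Section Modular.
Variables (S : signature) (C : algebra S -> Prop).
Hypothesis C_equational : equational_class C.
Hypothesis C_modular : congruence_modular C.

(** * Symmetry and monotonicity of the term condition under modularity *)

Section Centralizer.
Variable M : algebra S.
Hypothesis CM : C M.
Implicit Types (alpha beta delta phi : set (M * M)).

(* The term functions along the chain produced by modularity from the variable
   [(false, false)] to the variable [(false, true)] play the role of Day's
   terms; the four variables are the corners of a 2x2 matrix. *)
Lemma centralizes_sym_up alpha beta delta phi :
  Con alpha -> Con beta -> Con delta -> Con phi -> delta `<=` phi ->
  centralizes beta alpha delta -> centralizes alpha beta phi.
Proof.
move=> Ca Cb Cd Cp dp H m n t p q r s pq rs.
(* In this matrix [true] selects the top row ([p]) or the right column ([s]). *)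
pose E i j := eval (fcat (if i then p else q) (if j then s else r)) t.
rewrite -[eval (fcat p r) t]/(E true false).
rewrite -[eval (fcat p s) t]/(E true true).
rewrite -[eval (fcat q r) t]/(E false false).
rewrite -[eval (fcat q s) t]/(E false true) => Etop.
pose F := term_fun_algebra M (inhabits (false, false)).
pose x i j : F := term_fun_var M (i, j).
pose row_const (e : bool * bool -> M) := forall i, e (i, false) = e (i, true).
pose col_const (e : bool * bool -> M) := forall j, e (false, j) = e (true, j).
pose top_const (e : bool * bool -> M) := e (true, false) = e (true, true).
pose th_row : set (F * F) := agree_on row_const.
pose th_col : set (F * F) := agree_on col_const.
pose th_top : set (F * F) := agree_on top_const.
have Crow : Con th_row by apply: Con_agree_on.
have Ccol : Con th_col by apply: Con_agree_on.
have Ctop : Con th_top by apply: Con_agree_on.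
have top_row : th_top `<=` th_row by move=> [g h] gh e /(_ true); apply: gh.
(* For [R = r] the matrix has constant rows, so [g] takes the value [E false false] for both [Q = q]
   and [Q = p]. The condition [H], changing [r] to [s] in the block [R] along [beta], gives the
   claim. *)
have key (g : F) : th_row (x false false, g) ->
    delta (sval g (fun ij => E false ij.2), sval g (fun ij => E ij.1 ij.2)).
  have [tau gE] := svalP g => g_row; rewrite gE.
  have tau_row e : row_const e -> eval e tau = e (false, false).
    by move=> er; have := g_row e er; rewrite /= gE.
  pose T := ('I_n + 'I_n + 'I_m + 'I_m)%type.
  pose v (ij : bool * bool) (k : 'I_(m + n)) : term S T := Var S
    match split k with
    | inl k => if ij.1 then inr k else inl (inr k)
    | inr l => inl (inl (if ij.2 then inl l else inr l))
    end.
  pose tau' := term_subst (fun ij => term_subst (v ij) t) tau.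
  have ev R Q : eval (sum_fun (sum_fun (sum_fun R r) q) Q) tau' =
      eval (fun ij => eval (fcat (if ij.1 then Q else q)
                                 (if ij.2 then R else r)) t) tau.
    rewrite eval_subst; congr eval; apply/funext => -[i j].
    rewrite eval_subst; congr eval; apply/funext => k /=.
    by rewrite /fcat; case: (split k) => l; [case: i|case: j].
  have := @centralizesE _ _ _ _ _ H _ _ tau'
    (sum_fun (sum_fun r r) q) (sum_fun (sum_fun s r) q) q p.
  rewrite !ev.
  have -> : (fun ij : bool * bool => eval (fcat (if ij.1 then q else q)
      (if ij.2 then s else r)) t) = (fun ij => E false ij.2).
    by apply/funext => -[[] j].
  apply.
  - by move=> [[]|] k //=; apply: congr_refl.
  - by move=> k; apply: congr_sym.
  - by rewrite !tau_row //=; apply: congr_refl.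
(* The top row is made constant; by [Etop] the matrix changes only modulo [phi]. *)
pose Ephi (ij : bool * bool) := if ij.1 then E true false else E false ij.2.
have phiE (g : F) : phi (sval g (fun ij => E ij.1 ij.2), sval g Ephi).
  have [tau ->] := svalP g; apply: eval_congr => // -[[] j] /=;
    last exact: congr_refl.
  by case: j; rewrite /Ephi /=; [apply: congr_sym|apply: congr_refl].
pose mat (ij : bool * bool) := E ij.1 ij.2.
(* The corners are joined by [th_col], [th_top], [th_col] in turn, and the ends are related by
   [th_row]. As [th_top] lies below [th_row], the modular law moves the meet with [th_row] onto
   [th_col]. *)
have chain : join_chain th_top (th_col `&` th_row) (x false false) (x false true).
  apply: con_join_chain => //; first exact: Con_setI.
  have F_modular : modular_Con F.
    by apply: C_modular; apply: equational_class_term_fun.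
  rewrite F_modular //; split; last by move=> e /(_ false).
  have Cj := Con_join th_top th_col.
  apply: (congr_trans Cj (y := x true false)).
    by apply: con_join_subr => // e /(_ false).
  apply: (congr_trans Cj (y := x true true)).
    by apply: con_join_subl.
  by apply: con_join_subr => // e /(_ true).
suff: th_row (x false false, x false true) /\
      phi (E false false, sval (x false true) mat) by case.
elim: (clos_rt_rtn1 _ _ _ _ chain) => [|g h gh _ [IHrow IHphi]].
  by split; apply: congr_refl.
have row_gh : th_row (g, h) by case: gh => [/top_row|[]].
have row_h := congr_trans Crow IHrow row_gh.
split=> //; apply: (congr_trans Cp IHphi).
(* The two ends of a [th_top] link agree at [Ephi]. Those of the other kind of link agree at the
   matrix with both rows equal to the bottom one, which [key] compares with [E]. *)
case: gh => [gh|[gh _]].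
- apply: (congr_trans Cp (phiE g)).
  by rewrite (gh Ephi) //; apply: congr_sym => //; apply: phiE.
- have := congr_sym Cp (dp _ (key _ IHrow)).
  move/(congr_trans Cp); apply.
  by rewrite (gh (fun ij => E false ij.2)) //; apply/dp/key.
Qed.

(** The condition holds modulo the commutator; it is flipped there, then flipped back while the
    modulus grows to [phi]. *)
Lemma centralizes_commutator_sub alpha beta phi :
  Con alpha -> Con beta -> Con phi ->
  commutator alpha beta `<=` phi -> centralizes alpha beta phi.
Proof.
move=> Ca Cb Cp ab_phi; have Cc := Con_commutator alpha beta.
apply: (centralizes_sym_up Ca Cb Cc Cp ab_phi).
apply: (centralizes_sym_up Cb Ca Cc Cc) => //.
exact: centralizes_commutator.
Qed.

(** Modulo [phi], the congruence [phi] centralizes everything, so it can be joined to the first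
    argument; symmetry gives the same for the second. *)
Lemma centralizes_con_join alpha beta phi : Con alpha -> Con beta -> Con phi ->
  centralizes alpha beta phi ->
  centralizes (con_join alpha phi) (con_join beta phi) phi.
Proof.
move=> Ca Cb Cp H; have Cj := Con_join.
apply: (centralizes_sym_up (delta := phi)) => //.
apply: centralizes_join => //; last exact: centralizes_subl.
apply: (centralizes_sym_up (delta := phi)) => //.
by apply: centralizes_join => //; apply: centralizes_subl.
Qed.

(** If neither congruence lies below [phi], maximality makes both joins with [phi] equal to
    [nabla M]. Then [nabla M] centralizes itself modulo [phi], which forces [phi] to contain its
    commutator, [nabla M]. *)
Lemma Max_meet_prime phi alpha beta :
  commutator (nabla M) (nabla M) = nabla M ->
  Max phi -> Con alpha -> Con beta ->
  alpha `&` beta `<=` phi -> alpha `<=` phi \/ beta `<=` phi.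
Proof.
move=> nablaE [Cp phi_proper phi_max] Ca Cb ab_phi.
have join_nabla theta : Con theta -> ~ theta `<=` phi ->
    con_join theta phi = nabla M.
  move=> Ct nt; apply: contrapT => j_proper; apply: nt.
  by rewrite -(phi_max _ (Con_join _ _) j_proper (@con_join_subr _ _ _ _));
     apply: con_join_subl.
apply: contrapT => /not_orP [na nb].
have: centralizes alpha beta phi.
  by apply: centralizes_commutator_sub => // p /(commutator_subI Ca Cb)/ab_phi.
move/(centralizes_con_join Ca Cb Cp); rewrite !join_nabla // => cent.
apply: phi_proper; rewrite eqEsubset; split=> //.
by rewrite -{1}nablaE; apply: commutator_sub.
Qed.

End Centralizer.

Lemma Spec_meet_prime (M : algebra S) (phi alpha beta : set (M * M)) :
  Spec phi -> Con alpha -> Con beta ->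
  alpha `&` beta `<=` phi -> alpha `<=` phi \/ beta `<=` phi.
Proof.
move=> [_ _ prime] Ca Cb ab_phi; apply: prime => // p.
by move/(commutator_subI Ca Cb)/ab_phi.
Qed.

(** * Correspondence of congruences along a morphism with a set-theoretic section *)

Section Surjection.
Variables (M N : algebra S) (pi : hom M N) (s : N -> M).
Hypothesis sK : cancel s pi.

(** For [theta] containing the kernel of [pi] this is the image of [theta] under [pi]; the section
    chooses the representatives. *)
Definition con_image (theta : set (M * M)) : set (N * N) :=
  [set p | theta (s p.1, s p.2)].

Lemma Con_pullback psi : Con psi -> Con (hom_pullback pi psi).
Proof.
move=> Cp; rewrite /hom_pullback; split=> /= [x|x y|x y z|o x y xy].
- exact: congr_refl.
- exact: congr_sym.
- exact: congr_trans.
- by rewrite !hom_interp; apply: congr_interp.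
Qed.

Lemma pullback_sub psi psi' :
  hom_pullback pi psi `<=` hom_pullback pi psi' -> psi `<=` psi'.
Proof. by move=> h [u v]; have := h (s u, s v); rewrite /hom_pullback /= !sK. Qed.

Lemma pullback_nabla psi : (hom_pullback pi psi = nabla M) <-> (psi = nabla N).
Proof.
split=> [h|->] //; rewrite eqEsubset; split=> //.
by apply: pullback_sub; rewrite h.
Qed.

Section Image.
Variable theta : set (M * M).
Hypothesis Ct : Con theta.
Hypothesis ker_theta : forall x y, pi x = pi y -> theta (x, y).

Lemma Con_image : Con (con_image theta).
Proof.
rewrite /con_image; split=> /= [x|x y|x y z|o x y xy].
- exact: congr_refl.
- exact: congr_sym.
- exact: congr_trans.
(* The section need not be a morphism, but it commutes with operations up to the kernel of [pi]. *)
- have h w : theta (s (interp w), interp (s \o w)).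
    apply: ker_theta; rewrite sK hom_interp; congr interp.
    by apply/funext => k /=; rewrite sK.
  apply: (congr_trans Ct (h o x)); apply: (congr_trans Ct _ (congr_sym Ct (h o y))).
  exact: congr_interp.
Qed.

Lemma pullback_imageE : hom_pullback pi (con_image theta) = theta.
Proof.
have h x : theta (s (pi x), x) by apply: ker_theta; rewrite sK.
rewrite eqEsubset; split=> -[x y] xy.
  apply: (congr_trans Ct (congr_sym Ct (h x))).
  exact: (congr_trans Ct xy (h y)).
apply: (congr_trans Ct (h x)); apply: (congr_trans Ct xy).
exact: congr_sym (h y).
Qed.

End Image.

Lemma ker_pullback psi x y :
  Con psi -> pi x = pi y -> hom_pullback pi psi (x, y).
Proof. by move=> Cp xy; rewrite /hom_pullback /= xy; apply: congr_refl. Qed.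

Lemma hom_fcat m n (a : 'I_m -> M) (c : 'I_n -> M) :
  pi \o fcat a c = fcat (pi \o a) (pi \o c).
Proof. by apply/funext => k; rewrite /fcat /=; case: split. Qed.

(** Evaluation commutes with [pi], and tuples over [N] lift through [s]. *)
Lemma centralizes_pullback alpha beta delta :
  centralizes alpha beta delta <->
  centralizes (hom_pullback pi alpha) (hom_pullback pi beta)
    (hom_pullback pi delta).
Proof.
split=> H m n t a b c d ab cd.
  by rewrite /hom_pullback /= !eval_hom !hom_fcat; apply: H.
have sKo k (x : 'I_k -> N) : pi \o (s \o x) = x.
  by apply/funext => i /=; rewrite sK.
have := H m n t (s \o a) (s \o b) (s \o c) (s \o d).
rewrite /hom_pullback /= !eval_hom !hom_fcat !sKo; apply=> k; rewrite !sK.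
  exact: ab.
exact: cd.
Qed.

Lemma Max_pullback psi : Con psi -> Max (hom_pullback pi psi) <-> Max psi.
Proof.
move=> Cp; split=> [[_ proper max]|[_ proper max]]; split=> //.
- by move/pullback_nabla.
- move=> theta Ct nt sub; have: hom_pullback pi theta = hom_pullback pi psi.
    apply: max; first exact: Con_pullback.
      by move/pullback_nabla.
    by move=> p; apply: sub.
  by move=> e; rewrite eqEsubset; split; apply: pullback_sub; rewrite e.
- exact: Con_pullback.
- by move/pullback_nabla.
- move=> theta Ct nt sub.
  (* A congruence above a pullback contains the kernel of [pi], hence is itself a pullback and can
     be compared with [psi] in [N]. *)
  have ker x y : pi x = pi y -> theta (x, y).
    by move=> xy; apply: sub; apply: ker_pullback.
  rewrite -(pullback_imageE Ct ker); congr hom_pullback; apply: max.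
  + exact: Con_image.
  + by move=> e; apply: nt; rewrite -(pullback_imageE Ct ker) e.
  + by move=> [u v] uv; apply: sub; rewrite /hom_pullback /= !sK.
Qed.

Hypothesis CM : C M.

Lemma Spec_pullback psi : Con psi -> Spec (hom_pullback pi psi) <-> Spec psi.
Proof.
move=> Cp; have Cpp := Con_pullback Cp.
split=> [[_ proper prime]|[_ proper prime]]; split=> //.
- by move/pullback_nabla.
- move=> alpha beta Ca Cb ab_psi.
  have [||||] := prime (hom_pullback pi alpha) (hom_pullback pi beta).
  + exact: Con_pullback.
  + exact: Con_pullback.
  + suff: commutator (hom_pullback pi alpha) (hom_pullback pi beta) `<=`
          hom_pullback pi (commutator alpha beta).
      by move=> h p /h; apply: ab_psi.
    apply: commutator_sub; first by apply/Con_pullback; apply: Con_commutator.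
    by apply/centralizes_pullback; apply: centralizes_commutator.
  + by move/pullback_sub; left.
  + by move/pullback_sub; right.
- by move/pullback_nabla.
- move=> alpha beta Ca Cb ab_psi.
  (* [alpha] and [beta] need not contain the kernel of [pi]. Their joins with the pullback of [psi]
     do, and satisfy the same term condition, so they descend to [N]. *)
  pose joinp theta := con_join theta (hom_pullback pi psi).
  have Cj theta : Con (joinp theta) by apply: Con_join.
  have ker theta x y : pi x = pi y -> joinp theta (x, y).
    by move=> xy; apply: con_join_subr; apply: ker_pullback.
  have imgE theta := pullback_imageE (Cj theta) (@ker theta).
  have := centralizes_con_join CM Ca Cb Cpp
    (centralizes_commutator_sub CM Ca Cb Cpp ab_psi).
  rewrite -/(joinp alpha) -/(joinp beta) -(imgE alpha) -(imgE beta).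
  move/centralizes_pullback/(commutator_sub Cp) => h.
  have below theta : con_image (joinp theta) `<=` psi ->
      theta `<=` hom_pullback pi psi.
    move=> sub p tp.
    have: hom_pullback pi (con_image (joinp theta)) p.
      by rewrite imgE; apply: con_join_subl.
    exact: sub.
  have img theta : Con (con_image (joinp theta)).
    exact: Con_image (Cj theta) (@ker theta).
  by case: (prime _ _ (img alpha) (img beta) h) => /below; [left|right].
Qed.

End Surjection.

(** * Congruences of finite products and their projections *)

Section Products.
Variable n : nat.

Definition proj_hom (A : 'I_n -> algebra S) i : hom (prod_algebra A) (A i) :=
  @Hom S (prod_algebra A) (A i) (fun x => x i) (fun o x => erefl).

(** Non-emptiness of the product supplies the coordinates other than [i]. *)
Lemma proj_section (A : 'I_n -> algebra S) i :
  exists s : A i -> prod_algebra A, cancel s (proj_hom A i).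
Proof.
case: (carrier_inhabited (prod_algebra A)) => z.
by exists (fun x => dfwith z x) => x /=; rewrite dfwith_in.
Qed.

(** The meet of the kernels of the projections indexed by [r]. *)
Definition agree_at (A : 'I_n -> algebra S) (r : seq 'I_n) :
    set (prod_algebra A * prod_algebra A) :=
  [set p | forall i, i \in r -> p.1 i = p.2 i].

Lemma Con_agree_at A r : Con (@agree_at A r).
Proof.
rewrite /agree_at; split=> /= [x i //|x y h i /h //|x y z h1 h2 i ir|].
  exact: etrans (h1 i ir) (h2 i ir).
move=> o x y h i ir.
by congr interp; apply/funext => k; apply: h.
Qed.

(** The projection kernels meet in equality, which lies below [phi]. Meet-primeness splits off one
    kernel at a time; reaching the empty meet would make [phi] the full congruence. A kernel below
    [phi] makes [phi] a pullback. *)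
Lemma meet_prime_proj (A : 'I_n -> algebra S)
    (phi : set (prod_algebra A * prod_algebra A)) :
  Con phi -> phi <> nabla _ ->
  (forall alpha beta, Con alpha -> Con beta ->
     alpha `&` beta `<=` phi -> alpha `<=` phi \/ beta `<=` phi) ->
  exists i psi, Con psi /\ phi = hom_pullback (proj_hom A i) psi.
Proof.
move=> Cp proper prime.
have [i sub] : exists i, @agree_at A [:: i] `<=` phi.
  have: @agree_at A (enum 'I_n) `<=` phi.
    move=> [x y] /= h; have -> : x = y.
      by apply: functional_extensionality_dep => i; apply: h; rewrite mem_enum.
    exact: (congr_refl Cp).
  elim: (enum 'I_n) => [h|i r IH h].
    by case: proper; rewrite eqEsubset; split=> // p _; apply: h.
  have [||||] := prime (agree_at (A := A) [:: i]) (agree_at (A := A) r).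
  - exact: Con_agree_at.
  - exact: Con_agree_at.
  - move=> p [p1 p2]; apply: h => j; rewrite inE => /orP [/eqP ->|].
      by apply: p1; rewrite inE.
    exact: p2.
  - by exists i.
  - exact: IH.
have [s sK] := proj_section A i.
have ker x y : proj_hom A i x = proj_hom A i y -> phi (x, y).
  by move=> xy; apply: sub => j; rewrite inE => /eqP ->.
exists i, (con_image s phi); split; last by rewrite pullback_imageE.
exact: (Con_image sK).
Qed.

(** Projecting after the product morphism is [f i] after projecting, so the two iterated pullbacks
    coincide by conversion. The family [X] stands for [Max] or [Spec]. *)
Lemma prod_hom_preserves
    (X : forall M : algebra S, set (set (M * M)))
    (A B : 'I_n -> algebra S) (f : forall i, hom (A i) (B i)) :
  (forall M psi, X M psi -> Con psi) ->
  (forall i psi, Con psi ->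
     X _ (hom_pullback (proj_hom A i) psi) <-> X _ psi) ->
  (forall i psi, Con psi ->
     X _ (hom_pullback (proj_hom B i) psi) <-> X _ psi) ->
  (forall phi, X (prod_algebra B) phi ->
     exists i psi, Con psi /\ phi = hom_pullback (proj_hom B i) psi) ->
  (forall psi, X _ psi -> X _ (hom_pullback (prod_hom f) psi)) <->
  (forall i psi, X _ psi -> X _ (hom_pullback (f i) psi)).
Proof.
move=> XC XA XB Xproj.
have Cf i psi : Con psi -> Con (hom_pullback (f i) psi) by apply: Con_pullback.
split=> [H i psi Xpsi|H phi Xphi].
  have Cp := XC _ _ Xpsi.
  apply/(XA i); first exact: Cf.
  by apply: (H (hom_pullback (proj_hom B i) psi)); apply/XB.
have [i [psi [Cp phiE]]] := Xproj _ Xphi.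
move: Xphi; rewrite phiE => /(XB i _ Cp) /(H i).
by move/XA; apply; apply: Cf.
Qed.

End Products.
End Modular.

Theorem corollary5p4 (S : signature) (C : algebra S -> Prop)
    (C_equational : equational_class C)
    (C_modular : congruence_modular C)
    (C_nabla : forall M : algebra S,
       C M -> commutator (nabla M) (nabla M) = nabla M)
    (n : nat) (n_ge1 : 1 <= n)
    (A B : 'I_n -> algebra S)
    (A_in_C : forall i, C (A i)) (B_in_C : forall i, C (B i))
    (f : forall i, hom (A i) (B i)) :
  (Max_admissible (prod_hom f) <-> forall i, Max_admissible (f i)) /\
  (admissible (prod_hom f) <-> forall i, admissible (f i)).
Proof.
have CA := equational_class_prod C_equational A_in_C.
have CB := equational_class_prod C_equational B_in_C.
split; [apply: (prod_hom_preserves (X := @Max S))|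
        apply: (prod_hom_preserves (X := @Spec S))].
- by move=> M psi [].
- by move=> i psi Cp; have [s sK] := proj_section A i; apply: (Max_pullback sK).
- by move=> i psi Cp; have [s sK] := proj_section B i; apply: (Max_pullback sK).
- move=> phi Mphi; have [Cp proper _] := Mphi.
  apply: meet_prime_proj => // alpha beta.
  by apply: (Max_meet_prime C_equational C_modular CB); first exact: C_nabla.
- by move=> M psi [].
- move=> i psi Cp; have [s sK] := proj_section A i.
  exact: (Spec_pullback C_equational C_modular sK).
- move=> i psi Cp; have [s sK] := proj_section B i.
  exact: (Spec_pullback C_equational C_modular sK).
- move=> phi Sphi; have [Cp proper _] := Sphi.
  by apply: meet_prime_proj => // alpha beta; apply: Spec_meet_prime.
Qed.
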